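(* Let $p$ be an odd prime and $A\in\mathbb{Z}$. (i) If $p\mid A^2+4$, then $p\equiv1\pmod4$, $A/2\equiv(-1)^k\left(\frac{p-1}{2}\right)!\pmod p$ for some $k\in\{0,1\}$, and $$T_p(1,-A,-1)\equiv\begin{cases}(-1)^{(p+7)/8}\left(\frac{p-1}{2}\right)!\pmod p&\text{if }p\equiv1\pmod8,\\ (-1)^{k+(p-5)/8}\pmod p&\text{if }p\equiv5\pmod8.\end{cases}$$ (ii) If $\left(\frac{A^2+4}{p}\right)=1$, then $$T_p(1,-A,-1)\equiv\begin{cases}-(A^2+4)^{(p-1)/4}\pmod p&\text{if }p\equiv1\pmod4,\\ -(A^2+4)^{(p+1)/4}u_{(p-1)/2}(A)/2\pmod p&\text{if }p\equiv3\pmod4.\end{cases}$$ (iii) If $\left(\frac{A^2+4}{p}\right)=-1$, then $$T_p(1,-A,-1)\equiv\begin{cases}(-A^2-4)^{(p-1)/4}\pmod p&\text{if }p\equiv1\pmod4,\\ (-A^2-4)^{(p+1)/4}u_{(p+1)/2}(A)/2\pmod p&\text{if }p\equiv3\pmod4.\end{cases}$$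
   Context: $\left(\frac{\cdot}{p}\right)$ denotes the Legendre symbol. For an odd prime $p$ and $a,b,c\in\mathbb{Z}$, $T_p(a,b,c)=\prod_{i,j=1,\ p\nmid ai^2+bij+cj^2}^{(p-1)/2}(ai^2+bij+cj^2)$. For $A\in\mathbb{Z}$ the Lucas sequence $u_n(A)$ is defined by $u_0(A)=0$, $u_1(A)=1$, $u_{n+1}(A)=Au_n(A)+u_{n-1}(A)$ for $n\ge1$. Division by $2$ is understood modulo $p$. *)

(* Defs.v *)
From HB Require Import structures.
From mathcomp Require Import all_boot all_order all_algebra.
Set Implicit Arguments. Unset Strict Implicit. Unset Printing Implicit Defensive.
Import Order.TTheory GRing.Theory Num.Theory.
Local Open Scope ring_scope.

Definition legendre (a : int) (p : nat) : int :=
  if (p%:Z %| a)%Z then 0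
  else if [exists x : 'I_p, ((x%:Z) ^+ 2 == a %[mod p%:Z])%Z] then 1 else -1.

Definition Tp (p : nat) (a b c : int) : int :=
  \prod_(1 <= i < (p.-1)./2.+1)
    \prod_(1 <= j < (p.-1)./2.+1 |
            ~~ (p%:Z %| a * (i%:Z) ^+ 2 + b * i%:Z * j%:Z + c * (j%:Z) ^+ 2)%Z)
      (a * (i%:Z) ^+ 2 + b * i%:Z * j%:Z + c * (j%:Z) ^+ 2).

Fixpoint lucas_u (A : int) (n : nat) : int :=
  match n with
  | 0 => 0
  | 1 => 1
  | (m.+1 as n').+1 => A * lucas_u A n' + lucas_u A m
  end.

(* Main.v *)
Require Import Defs.
From HB Require Import structures.
From mathcomp Require Import all_boot all_order all_algebra all_field.
From mathcomp Require Import ring zify.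
Import Order.TTheory GRing.Theory Num.Theory.
Local Open Scope ring_scope.
Set Implicit Arguments. Unset Strict Implicit. Unset Printing Implicit Defensive.

(* Write f(r) = r^2 - A r - 1, so that the form is j^2 f(i / j), and let n be
   (p - 1) / 2.  Sorting the pairs (i, j) by their ratio r = i / j and matching
   r with -1/r, Gauss's lemma gives the contribution n!^2 (r f(r))^n of the two
   ratios together.  If y is a root of f, possibly in an extension field, then
   y f(r) = - r (y - r) (y + 1/r), so the product over all pairs becomes the
   n-th power of the product of the y - r, which X^p - X = prod_r (X - r)
   evaluates.  When p = 1 mod 4, the two ratios with r^2 = -1 are fixed by the
   matching and are computed separately, using the bijection j |-> r j between
   the j with r j in {1, .., n} and the others.  When f has no root mod p, the
   value of y^(p+1) = -1 comes from Frobenius exchanging y and -1/y. *)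

(** Each orbit of [s] has exactly two points and is represented by the one of smaller rank. The
    operation stays abstract so that one splitting serves both to count ratios and to multiply their
    contributions. *)
Lemma big_fixfree_involution (R : Type) (idx : R) (op : Monoid.com_law idx)
    (I : finType) (P : pred I) (s : I -> I) (G : I -> R) :
    (forall x, P x -> [/\ P (s x), s (s x) = x & s x != x]) ->
  \big[op/idx]_(x | P x) G x =
  \big[op/idx]_(x | P x && (enum_rank x < enum_rank (s x))%N) op (G x) (G (s x)).
Proof.
move=> Ps; rewrite (bigID (fun x => (enum_rank x < enum_rank (s x))%N)) /=.
rewrite big_split; congr (op _ _).
rewrite (reindex_onto s s) => [|x /andP[/Ps[]]//].
apply: eq_bigl => x; apply/idP/idP.
- case/andP=> /andP[Psx lt] /eqP sx; have [] := Ps _ Psx; rewrite sx => Px _ ne.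
  rewrite sx in lt; rewrite Px /= ltn_neqAle leqNgt lt andbT.
  by apply: contra ne => /eqP/val_inj/enum_rank_inj {1}->.
- case/andP=> Px lt; have [-> -> _] := Ps _ Px.
  by rewrite eqxx -leqNgt (ltnW lt).
Qed.

(** * Half-systems of a finite field: Wilson's theorem and Gauss's lemma *)

Section HalfSystem.

Variables (F : finFieldType) (H : pred F).
Hypothesis H0 : ~~ H 0.
Hypothesis HN : forall x : F, x != 0 -> H (- x) = ~~ H x.

Let n := #|H|.
Let h : F := \prod_(j | H j) j.

Lemma half_neq0 (x : F) : H x -> x != 0.
Proof. by move=> Hx; apply: contraNneq H0 => <-. Qed.

Lemma half_oppr_neq (x : F) : x != 0 -> - x != x.
Proof. by move=> /HN Hx; apply/eqP => xN; rewrite xN in Hx; case: (H x) Hx. Qed.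

Lemma half_two_neq0 : 2%:R != 0 :> F.
Proof.
have := half_oppr_neq (oner_neq0 F); apply: contra => /eqP two0.
by rewrite -subr_eq0 -opprD oppr_eq0 -[1 + 1]/(2%:R : F) two0.
Qed.

Lemma big_half (R : Type) (idx : R) (op : Monoid.com_law idx) (G : F -> R) :
  \big[op/idx]_(x | x != 0) G x = \big[op/idx]_(x | H x) op (G x) (G (- x)).
Proof.
rewrite (bigID H) /= big_split; congr (op _ _).
  by apply: eq_bigl => x; case: (boolP (H x)) => [/half_neq0->|]; rewrite ?andbF.
rewrite (reindex_inj oppr_inj); apply: eq_bigl => x; rewrite oppr_eq0.
have [->|x0] := eqVneq x 0; first by rewrite (negbTE H0).
by rewrite HN // negbK.
Qed.

Lemma card_nonzero_half : #|[pred x : F | x != 0]| = n.*2.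
Proof.
by rewrite -sum1_card (big_half addn) sum_nat_const muln2.
Qed.

Lemma card_half : #|F| = n.*2.+1.
Proof.
rewrite -card_nonzero_half (cardD1 0) inE add1n; congr _.+1.
by apply: eq_card => x; rewrite !inE andbT.
Qed.

Lemma expf_half (x : F) : x != 0 -> x ^+ n.*2 = 1.
Proof.
by move=> x0; apply: (mulfI x0); rewrite -exprS -card_half expf_card mulr1.
Qed.

Lemma prod_subr_all (E : fieldType) (phi : {rmorphism F -> E}) (y : E) :
  \prod_r (y - phi r) = y ^+ n.*2.+1 - y.
Proof.
have := congr1 (fun q => (map_poly phi q).[y]) (finField_genPoly F).
rewrite rmorphB rmorph_prod /= map_polyXn map_polyX hornerD hornerN hornerXn.
rewrite hornerX horner_prod card_half => ->; apply: eq_bigr => r _.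
by rewrite rmorphB /= map_polyX map_polyC hornerXsubC.
Qed.

Lemma half_card_gt0 : (0 < n)%N.
Proof.
rewrite -double_gt0 -card_nonzero_half; apply/card_gt0P.
by exists 1; rewrite inE oner_neq0.
Qed.

(** Wilson's theorem: cancel X in X^q - X = prod_r (X - r) and evaluate at 0; replacing [r] by [- r]
    absorbs the signs. *)
Lemma prod_nonzero : \prod_(x : F | x != 0) x = -1.
Proof.
have := finField_genPoly F; rewrite card_half (bigD1 0) //= polyC0 subr0.
rewrite exprS -[X in _ - X]mulr1 -mulrBr => /(mulfI (negbT (polyX_eq0 F))).
move/(congr1 (fun q : {poly F} => q.[0])).
rewrite hornerD hornerN hornerXn hornerC expr0n double_eq0.
rewrite (negbTE (lt0n_neq0 half_card_gt0)) sub0r horner_prod => ->.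
rewrite (reindex_inj oppr_inj) /=.
by apply: eq_big => x; rewrite ?oppr_eq0 // hornerXsubC sub0r.
Qed.

(** Pairing [x] with [- x] in Wilson's theorem gives (-1)^n h^2 = -1. *)
Lemma sqr_prod_half : h ^+ 2 = (-1) ^+ n.+1.
Proof.
have := prod_nonzero; rewrite (big_half *%R) /=.
under eq_bigr => x _ do rewrite mulrN -mulN1r.
rewrite !big_split prodr_const /= -/h -/n -expr2 => hE.
apply: (mulfI (x := (-1) ^+ n)); first by rewrite expf_neq0 // oppr_eq0 oner_neq0.
by rewrite hE exprS mulrCA -exprMn mulrNN mulr1 expr1n mulr1.
Qed.

(** Gauss's lemma: sending [j] to [a (x * j)], the representative of [x * j] up to sign in [H],
    permutes [H]. So the product of all [x * j] is [h] times the signs. *)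
Lemma gauss_half (x : F) :
  x != 0 -> x ^+ n = \prod_(j | H j) (if H (x * j) then 1 else -1).
Proof.
move=> x0.
have h0 : h != 0 by apply/prodf_neq0 => j /half_neq0.
apply: (mulIf h0); rewrite [in LHS]/h /n -prodr_const -[in LHS]big_split /=.
pose a y := if H y then y else - y.
have aH y : y != 0 -> H (a y).
  by move=> y0; rewrite /a; case: ifP => // /negbT; rewrite HN.
have aM (c y : F) : a (c * a y) = a (c * y) \/ c * y = 0.
  rewrite {2}/a; case: (boolP (H y)) => Hy; first by left.
  rewrite mulrN /a; have [->|z0] := eqVneq (c * y) 0; [by right|left].
  by rewrite HN //; case: (H _); rewrite ?opprK.
have aid y : H y -> a y = y by rewrite /a => ->.
have -> : h = \prod_(j | H j) a (x * j).
  rewrite /h (reindex_onto (fun j => a (x * j)) (fun j => a (x^-1 * j))).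
    apply: eq_bigl => j; apply/andP/idP => [[Hj /eqP <-]|Hj].
      by apply: aH; rewrite mulf_neq0 ?invr_eq0 // half_neq0.
    have j0 := half_neq0 Hj; split; first by apply: aH; rewrite mulf_neq0.
    case: (aM x^-1 (x * j)) => [->|/eqP]; rewrite mulKf // ?(negbTE j0) //.
    by rewrite aid.
  move=> j Hj; have j0 := half_neq0 Hj.
  by case: (aM x (x^-1 * j)) => [->|/eqP]; rewrite mulVKf // ?(negbTE j0) // aid.
rewrite -big_split /=; apply: eq_bigr => j Hj; rewrite /a.
by case: ifP => _; rewrite ?mul1r ?mulrNN ?mul1r.
Qed.

(** * Sorting the values of the form by the ratio r = i / j *)

Variable A : F.

Let q (i j : F) := i ^+ 2 - A * i * j - j ^+ 2.
Let f (r : F) := r ^+ 2 - A * r - 1.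
Let T := \prod_(i | H i) \prod_(j | H j && (q i j != 0)) q i j.

(* The part of [T] carried by the line [i = r * j]. *)
Let g (r : F) := \prod_(j | H j && H (r * j)) (j ^+ 2 * f r).

Lemma prod_form_by_ratio : T = \prod_(r | (r != 0) && (f r != 0)) g r.
Proof.
(* [c] turns the excluded zero values into factors 1, so that the two products can be exchanged
   freely. *)
pose c (x : F) := if x != 0 then x else 1.
transitivity (\prod_(j | H j) \prod_(i | H i) c (q i j)).
  rewrite exchange_big /=; apply: eq_bigr => i _.
  by rewrite big_mkcondr.
transitivity (\prod_(j | H j) \prod_(r | H (r * j)) c (j ^+ 2 * f r)).
  apply: eq_bigr => j /half_neq0 j0.
  rewrite (reindex_inj (mulIf j0)) /=; apply: eq_bigr => r _.
  by congr (c _); rewrite /q /f; ring.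
rewrite (exchange_big_dep xpredT) //= [RHS]big_mkcond; apply: eq_bigr => r _.
have [->|r0] /= := eqVneq r 0.
  by apply: big1 => j /andP[_]; rewrite mul0r (negbTE H0).
have [f0|f0] /= := eqVneq (f r) 0.
  by apply: big1 => j _; rewrite /c f0 mulr0 eqxx.
apply: eq_bigr => j /andP[/half_neq0 j0 _].
by rewrite /c mulf_neq0 // expf_neq0.
Qed.

Lemma form_ratio_pair (r : F) : r != 0 -> f (- r^-1) = - f r / r ^+ 2.
Proof. by move=> r0; rewrite /f; field. Qed.

(** Substituting [- r * j] for [j] carries the line of -1/r to the [j] in [H] with [r * j] outside
    [H], with values - j^2 f(r). Both lines together run through all of [H], and Gauss's lemma
    collects the signs into r^n. *)
Lemma line_pair (r : F) :
  r != 0 -> g r * g (- r^-1) = h ^+ 2 * (r * f r) ^+ n.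
Proof.
move=> r0; have Nr0 : - r != 0 by rewrite oppr_eq0.
have -> : g (- r^-1) = \prod_(j | H j && ~~ H (r * j)) - (j ^+ 2 * f r).
  rewrite /g (reindex_inj (mulfI Nr0)) /=; apply: eq_big => [j|j _].
    rewrite mulrA mulrNN mulVf // mul1r andbC; case: (boolP (H j)) => //= Hj.
    by rewrite mulNr HN // mulf_neq0 // half_neq0.
  by rewrite form_ratio_pair //; field.
have -> : h ^+ 2 * (r * f r) ^+ n =
    \prod_(j | H j) (j ^+ 2 * f r * (if H (r * j) then 1 else -1)).
  rewrite 2!big_split /= -gauss_half // prodr_const exprMn prodrXl -/h -/n.
  by ring.
rewrite [RHS](bigID (fun j => H (r * j))) /=; congr (_ * _).
  by apply: eq_bigr => j /andP[_ ->]; rewrite mulr1.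
by apply: eq_bigr => j /andP[_ /negbTE->]; rewrite mulrN1.
Qed.

(** Since r = -1/r means r^2 = -1, the matching has no fixed point here; [Z] below collects the
    fixed ratios. *)
Let P' (r : F) := [&& r != 0, f r != 0 & r ^+ 2 != -1].

Lemma ratio_pairing (r : F) :
  P' r -> [/\ P' (- r^-1), - (- r^-1)^-1 = r & - r^-1 != r].
Proof.
case/and3P=> r0 f0 r2; split.
- rewrite /P' oppr_eq0 invr_eq0 r0 form_ratio_pair // mulf_neq0 ?oppr_eq0 //=.
    apply: contra r2 => /eqP e; rewrite -[r]invrK exprVn -sqrrN e.
    by rewrite invrN invr1.
  by rewrite invr_eq0 expf_neq0.
- by rewrite invrN invrK opprK.
- by apply: contra r2 => /eqP e; rewrite expr2 -{1}e mulNr mulVf.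
Qed.

Let Z := \prod_(r | (r != 0) && (f r != 0) && (r ^+ 2 == -1)) g r.

Lemma ratio_partition (R : Type) (idx : R) (op : Monoid.com_law idx) (G : F -> R) :
  \big[op/idx]_(r | (r != 0) && (f r != 0)) G r =
  op (\big[op/idx]_(r | P' r) G r)
     (\big[op/idx]_(r | (r != 0) && (f r != 0) && (r ^+ 2 == -1)) G r).
Proof.
rewrite (bigID (fun r => r ^+ 2 != -1)) /=; congr (op _ _).
  by apply: eq_bigl => r; rewrite /P' andbA.
by apply: eq_bigl => r; rewrite negbK.
Qed.

(** * The product over the ratios through a root of [f] in an extension *)

Section Extension.

Variables (E : fieldType) (phi : {rmorphism F -> E}) (y : E).
Hypothesis yP : y ^+ 2 = phi A * y + 1.

Lemma root_neq0 : y != 0.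
Proof.
apply/eqP => y0; move/eqP: yP.
by rewrite y0 expr0n mulr0 add0r eq_sym oner_eq0.
Qed.

(* Up to the square [r ^ 2], the form value [r f(r)] is
   [- (y - r) (y + 1 / r) / y]. *)
Lemma form_prod_as_norm :
  exists2 N, #|P'| = N.*2 &
    y ^+ (n * N) * phi T =
    (-1) ^+ N * (\prod_(r | P' r) (y - phi r)) ^+ n * phi Z.
Proof.
(* [R'] keeps one ratio from each pair {r, -1/r}, so [N] counts the pairs. *)
pose R' (r : F) := P' r && (enum_rank r < enum_rank (- r^-1)%R)%N.
exists #|R'|.
  rewrite -sum1_card (big_fixfree_involution addn _ ratio_pairing).
  by rewrite sum_nat_const muln2.
rewrite prod_form_by_ratio ratio_partition rmorphM mulrA; congr (_ * _).
rewrite !(big_fixfree_involution *%R _ ratio_pairing) /=.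
rewrite rmorph_prod -prodrXl exprM -!prodr_const -!big_split /=.
apply: eq_bigr => r /andP[/and3P[r0 _ _] _].
rewrite line_pair // sqr_prod_half rmorphM prodr_const mulrCA.
rewrite [X in _ * (_ * X)]rmorphXn -[X in _ * X = _]exprMn.
have phir0 : phi r != 0 by rewrite fmorph_eq0.
have -> : y * phi (r * f r) =
    phi (r ^+ 2) * - ((y - phi r) * (y - phi (- r^-1))).
  rewrite !(rmorphM, rmorphB, rmorphN, rmorphXn, rmorph1, fmorphV) /=.
  have -> : y * (phi r * (phi r ^+ 2 - phi A * phi r - 1)) =
    phi r ^+ 3 * y - phi r ^+ 2 * (phi A * y + 1) + phi r ^+ 2 - phi r * y by ring.
  by rewrite -yP; field.
(* r^(2n) = 1 removes the square; the sign (-1)^(n+1) of h^2 and a further (-1)^n then leave a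
   single -1 for each pair. *)
rewrite [X in _ * X = _]exprMn -rmorphXn -exprM mul2n expf_half // rmorph1 mul1r.
rewrite [X in _ * X = _]exprNn.
rewrite mulrA rmorphXn rmorphN rmorph1 -exprD addSn addnn exprS.
by rewrite -mul2n exprM sqrrN expr1n expr1n mulr1.
Qed.

End Extension.

(** * The ratios fixed by the matching: r^2 = -1 *)

Lemma sqrN1_neq0 (r : F) : r ^+ 2 = -1 -> r != 0.
Proof.
move=> r2; apply/eqP => r0; move/eqP: r2.
by rewrite r0 expr0n eq_sym oppr_eq0 oner_eq0.
Qed.

Lemma neg1_half_neq1 : -1 != 1 :> F.
Proof. exact: half_oppr_neq (oner_neq0 F). Qed.

(** Otherwise 1 = r^(2n) = (-1)^n = -1. *)
Lemma sqr_neqN1 (r : F) : odd n -> r ^+ 2 != -1.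
Proof.
move=> on; apply/eqP => r2; apply: (elimN eqP neg1_half_neq1).
have r0 := sqrN1_neq0 r2.
by rewrite -[RHS](expf_half r0) -mul2n exprM r2 -signr_odd on.
Qed.

Lemma big_sqrN1 (R : Type) (idx : R) (op : Monoid.com_law idx) (G : F -> R) (i : F) :
  i ^+ 2 = -1 -> \big[op/idx]_(r | r ^+ 2 == -1) G r = op (G i) (G (- i)).
Proof.
move=> i2; have i0 := sqrN1_neq0 i2.
rewrite (bigD1 i) ?i2 //= (bigD1 (- i)) ?sqrrN ?i2 ?half_oppr_neq ?eqxx //=.
rewrite big1 ?Monoid.mulm1 // => r /andP[/andP[r2 ri] rNi].
by move: r2; rewrite -i2 eqf_sqr (negbTE ri) (negbTE rNi).
Qed.

(** When [j] and [i * j] lie in [H], [i * (i * j) = - j] does not; these [i * j] are exactly the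
    elements of [H] that multiplication by [i] moves out of [H]. *)
Lemma big_half_imag (R : Type) (idx : R) (op : Monoid.com_law idx) (G : F -> R)
    (i : F) : i ^+ 2 = -1 ->
  \big[op/idx]_(j | H j) G j =
  op (\big[op/idx]_(j | H j && H (i * j)) G j)
     (\big[op/idx]_(j | H j && H (i * j)) G (i * j)).
Proof.
move=> i2; have i0 := sqrN1_neq0 i2.
rewrite (bigID (fun j => H (i * j))) /=; congr (op _ _).
rewrite (reindex_inj (mulfI i0)) /=; apply: eq_bigl => j.
rewrite mulrA -expr2 i2 mulN1r andbC; have [->|j0] := eqVneq j 0.
  by rewrite mulr0 (negbTE H0) !andbF.
by rewrite HN // negbK.
Qed.

(** Here f(i) = i (2i - A), and splitting [H] by [i] shows that h is i^m times the product of j^2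
    over the [m] indices [j] of the line. *)
Lemma line_imag (i : F) (m : nat) :
  i ^+ 2 = -1 -> n = m.*2 -> g i = h * (2 * i - A) ^+ m.
Proof.
move=> i2 nm.
have mE : #|[pred j | H j && H (i * j)]| = m.
  apply: double_inj; rewrite -nm /n -[RHS]sum1_card (big_half_imag addn _ i2) /=.
  by rewrite sum_nat_const muln1 addnn.
rewrite /g big_split /= prodr_const mE.
have -> : h = i ^+ m * \prod_(j | H j && H (i * j)) j ^+ 2.
  rewrite /h (big_half_imag *%R _ i2) /= big_split prodr_const mE /= prodrXl.
  by ring.
rewrite [LHS]mulrC [RHS]mulrAC -exprMn; congr (_ ^+ _ * _).
by rewrite /f mulrBr mulrCA -expr2 i2; ring.
Qed.

Lemma sqr_prod_half_even : ~~ odd n -> h ^+ 2 = -1.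
Proof. by move=> /negbTE en; rewrite sqr_prod_half -signr_odd /= en. Qed.

Section ImaginaryLines.

Variable m : nat.
Hypothesis nm : n = m.*2.
Hypothesis D0 : A ^+ 2 + 4 != 0.

Lemma form_neq0_imag (r : F) : r ^+ 2 = -1 -> f r != 0.
Proof.
move=> r2; apply: contra D0 => /eqP f0; apply/eqP.
have Ar : A * r = -2.
  by apply/eqP; rewrite -subr_eq0 -oppr_eq0 -f0 /f r2; apply/eqP; ring.
have: (A * r) ^+ 2 = 4 by rewrite Ar; ring.
by rewrite exprMn r2 => <-; ring.
Qed.

Lemma ratio_partition_imag (R : Type) (idx : R) (op : Monoid.com_law idx)
    (G : F -> R) (i : F) : i ^+ 2 = -1 ->
  \big[op/idx]_(r | (r != 0) && (f r != 0)) G r =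
  op (\big[op/idx]_(r | P' r) G r) (op (G i) (G (- i))).
Proof.
move=> i2; rewrite ratio_partition -(big_sqrN1 _ _ i2); congr (op _ _).
apply: eq_bigl => r; have [/eqP r2|] := boolP (r ^+ 2 == -1); last by rewrite andbF.
by rewrite (sqrN1_neq0 r2) (form_neq0_imag r2).
Qed.

Lemma imag_lines : Z = - (A ^+ 2 + 4) ^+ m.
Proof.
have h2 : h ^+ 2 = -1 by apply: sqr_prod_half_even; rewrite nm odd_double.
have Nh2 : (- h) ^+ 2 = -1 by rewrite sqrrN.
(* As [n] is even, [h] is itself a square root of -1, so the fixed ratios are [h] and [- h]. *)
transitivity (g h * g (- h)).
  rewrite -(big_sqrN1 *%R g h2); apply: eq_bigl => r.
  have [/eqP r2|] := boolP (r ^+ 2 == -1); last by rewrite andbF.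
  by rewrite (sqrN1_neq0 r2) (form_neq0_imag r2).
rewrite (line_imag h2 nm) (line_imag Nh2 nm) mulrACA -expr2 h2 mulN1r -exprMn.
congr (- _ ^+ _); have -> : (2 * h - A) * (2 * - h - A) = A ^+ 2 - 4 * h ^+ 2 by ring.
by rewrite h2 mulrN1 opprK.
Qed.

End ImaginaryLines.

Lemma imag_lines_odd : odd n -> Z = 1.
Proof.
by move=> on; apply: big1 => r /andP[_]; rewrite (negbTE (sqr_neqN1 r on)).
Qed.

Lemma ratio_nonzero_odd (r : F) : odd n -> P' r = (r != 0) && (f r != 0).
Proof. by move=> on; rewrite /P' sqr_neqN1 // andbT. Qed.

(** Wilson's theorem after replacing [r] by [y - r]. The factor 1 at [r = y] keeps all of [F] as
    index set, ready for the decompositions by ratio. *)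
Lemma prod_subr_punctured (y : F) :
  \prod_r (if r == y then 1 else y - r) = -1.
Proof.
rewrite -prod_nonzero (bigD1 y) //= eqxx mul1r.
rewrite [RHS](reindex_inj (subrI y)) /=.
apply: eq_big => [r|r /negbTE-> //].
by rewrite subr_eq0 eq_sym.
Qed.

(** * Split case: the roots [y] and [A - y] lie in the field *)

Section SplitCase.

Variable y : F.
Hypothesis yP : y ^+ 2 = A * y + 1.

Lemma form_split (r : F) : f r = (r - y) * (r - (A - y)).
Proof.
have -> : (r - y) * (r - (A - y)) = r ^+ 2 - A * r + A * y - y ^+ 2 by ring.
by rewrite yP /f; ring.
Qed.

Lemma split_neq0 : y != 0.
Proof. exact: (root_neq0 (phi := idfun) yP). Qed.

Lemma split_mulr_conj : y * (A - y) = -1.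
Proof. by rewrite mulrBr -expr2 yP; ring. Qed.

Lemma conj_root_neq0 : A - y != 0.
Proof.
apply/eqP => d; have /eqP := split_mulr_conj.
by rewrite d mulr0 eq_sym oppr_eq0 oner_eq0.
Qed.

Lemma split_sqr_add1 : y * (y - (A - y)) = y ^+ 2 + 1.
Proof. by rewrite mulrBr split_mulr_conj opprK -expr2. Qed.

Lemma split_disc : A ^+ 2 + 4 = (y - (A - y)) ^+ 2.
Proof.
have -> : (y - (A - y)) ^+ 2 = A ^+ 2 - 4 * (y * (A - y)) by ring.
by rewrite split_mulr_conj mulrN1 opprK.
Qed.

Hypothesis D0 : A ^+ 2 + 4 != 0.

Lemma split_diff_neq0 : y - (A - y) != 0.
Proof. by move: D0; rewrite split_disc expf_eq0. Qed.

Lemma split_sqr_add1_neq0 : y ^+ 2 + 1 != 0.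
Proof. by rewrite -split_sqr_add1 mulf_neq0 ?split_neq0 ?split_diff_neq0. Qed.

Lemma big_split_ratios (R : Type) (idx : R) (op : Monoid.com_law idx) (G : F -> R) :
  \big[op/idx]_r G r =
  op (G 0) (op (G y) (op (G (A - y)) (\big[op/idx]_(r | (r != 0) && (f r != 0)) G r))).
Proof.
rewrite (bigD1 0) // (bigD1 y) ?split_neq0 // (bigD1 (A - y)) /=; last first.
  by rewrite conj_root_neq0 eq_sym -subr_eq0 split_diff_neq0.
do 3![congr (op _ _)]; apply: eq_bigl => r.
by rewrite form_split mulf_eq0 !subr_eq0 negb_or andbA.
Qed.

(** The punctured product also contains r = 0 and r = A - y, whose factors y and y - (A - y)
    multiply to y^2 + 1. *)
Lemma split_prod_ratios :
  (y ^+ 2 + 1) * \prod_(r | (r != 0) && (f r != 0)) (y - r) = -1.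
Proof.
rewrite -(prod_subr_punctured y) (big_split_ratios *%R) /= eqxx mul1r.
rewrite eq_sym (negbTE split_neq0) subr0 ifN; last first.
  by rewrite eq_sym -subr_eq0 split_diff_neq0.
rewrite mulrA split_sqr_add1; congr (_ * _); apply: eq_bigr => r /andP[_].
by rewrite form_split mulf_eq0 subr_eq0 negb_or => /andP[/negbTE->].
Qed.

Lemma split_card_ratios :
  (\sum_(r | (r != 0%R) && (f r != 0%R)) 1 = n.*2 - 2)%N.
Proof.
have := card_half; rewrite -sum1_card (big_split_ratios addn) /= => e; lia.
Qed.

Lemma form_prod_split_odd : odd n -> T = - (y ^+ 2 + 1) ^+ n.
Proof.
move=> on; have [N cN] := form_prod_as_norm (phi := idfun) yP.
have PE : P' =1 [pred r | (r != 0) && (f r != 0)].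
  by move=> r; rewrite ratio_nonzero_odd.
rewrite imag_lines_odd // (eq_bigl _ _ PE) mulr1 /=.
(* All 2n - 2 ratios are paired, so N = n - 1 is even; writing it as a double shows that 2n divides
   n N. *)
have {cN} NE : N = n.-1./2.*2.
  by have := split_card_ratios; rewrite -(eq_bigl _ _ PE) sum1_card cN /=; lia.
rewrite NE -doubleMr doubleMl exprM (expf_half split_neq0) expr1n mul1r.
rewrite -signr_odd odd_double mul1r => ->.
apply: (mulfI (expf_neq0 n split_sqr_add1_neq0)).
rewrite -exprMn split_prod_ratios mulrN -exprD addnn.
by rewrite (expf_half split_sqr_add1_neq0) -signr_odd on.
Qed.

(** The factors of [h] and [- h] multiply to y^2 + 1, so the paired ratios have a product [W] with
    (y^2 + 1)^2 W = -1. For even [n] this gives W^n = 1, and only [Z] survives. *)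
Lemma form_prod_split_even (m : nat) : n = m.*2 -> T = - (A ^+ 2 + 4) ^+ m.
Proof.
move=> nm; have [N cN] := form_prod_as_norm (phi := idfun) yP.
have h2 : h ^+ 2 = -1 by apply: sqr_prod_half_even; rewrite nm odd_double.
have NE : N = m.-1.*2.
  have := split_card_ratios; have := half_card_gt0.
  by rewrite (ratio_partition_imag D0 addn _ h2) sum1_card cN nm /=; lia.
have := split_prod_ratios; rewrite (ratio_partition_imag D0 *%R _ h2) /= opprK.
have -> : (y - h) * (y + h) = y ^+ 2 - h ^+ 2 by ring.
rewrite h2 opprK; set W := \prod_(r | P' r) (y - r) => WE.
rewrite NE -doubleMr doubleMl exprM (expf_half split_neq0) expr1n mul1r.
rewrite -signr_odd odd_double mul1r => -> /=.
have -> : W ^+ n = 1.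
  transitivity (((y ^+ 2 + 1) * (W * (y ^+ 2 + 1))) ^+ n).
    rewrite mulrCA -expr2 exprMn -exprM mul2n.
    by rewrite (expf_half split_sqr_add1_neq0) mulr1.
  by rewrite WE -signr_odd nm odd_double.
by rewrite mul1r (imag_lines nm D0).
Qed.

End SplitCase.

(** * Inert case: no root in the field, and y^(q+1) = -1 in the extension *)

Section InertCase.

Variables (E : fieldType) (phi : {rmorphism F -> E}) (y : E).
Hypothesis yP : y ^+ 2 = phi A * y + 1.
Hypothesis f_neq0 : forall r, f r != 0.
Hypothesis y_norm : y ^+ n.+1.*2 = -1.

Let d := y - (phi A - y).

Lemma inert_mulr_conj : y * (phi A - y) = -1.
Proof. by rewrite mulrBr -expr2 yP; ring. Qed.

Lemma inert_sqr_add1 : y * d = y ^+ 2 + 1.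
Proof. by rewrite mulrBr inert_mulr_conj opprK -expr2. Qed.

Lemma inert_disc : phi (A ^+ 2 + 4) = d ^+ 2.
Proof.
have -> : d ^+ 2 = phi A ^+ 2 - 4 * (y * (phi A - y)) by rewrite /d; ring.
by rewrite inert_mulr_conj mulrN1 opprK rmorphD rmorphXn rmorph_nat.
Qed.

Lemma big_inert_ratios (R : Type) (idx : R) (op : Monoid.com_law idx) (G : F -> R) :
  \big[op/idx]_r G r =
  op (G 0) (\big[op/idx]_(r | (r != 0) && (f r != 0)) G r).
Proof.
rewrite (bigD1 0) //=; congr (op _ _); apply: eq_bigl => r.
by rewrite f_neq0 andbT.
Qed.

(** The product over all [r] is y^q - y; multiplied by [y] it becomes -1 - y^2 = - y d. *)
Lemma inert_prod_ratios :
  y * \prod_(r | (r != 0) && (f r != 0)) (y - phi r) = - d.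
Proof.
apply: (mulfI (root_neq0 yP)).
have := prod_subr_all phi y; rewrite (big_inert_ratios *%R) rmorph0 subr0 /= => ->.
rewrite mulrBr -exprS -doubleS y_norm mulrN inert_sqr_add1; ring.
Qed.

Lemma inert_card_ratios :
  (\sum_(r | (r != 0%R) && (f r != 0%R)) 1 = n.*2)%N.
Proof.
by have := card_half; rewrite -sum1_card (big_inert_ratios addn) /= add1n; case.
Qed.

Lemma form_prod_inert_odd (m : nat) :
  n.+1 = m.*2 -> phi T = (-1) ^+ m * y ^+ n.+1 * d ^+ n.
Proof.
move=> nm; have on : odd n by rewrite -[odd n]negbK -oddS nm odd_double.
have [N cN] := form_prod_as_norm yP.
have PE : P' =1 [pred r | (r != 0) && (f r != 0)].
  by move=> r; rewrite ratio_nonzero_odd.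
rewrite imag_lines_odd // (eq_bigl _ _ PE) rmorph1 mulr1 /=.
have -> : N = n.
  apply: double_inj; rewrite -inert_card_ratios -(eq_bigl _ _ PE) sum1_card.
  exact: esym.
rewrite -signr_odd on mulN1r => TE.
have {}TE : y ^+ (n * n.+1) * phi T = d ^+ n.
  rewrite mulnS addnC exprD mulrAC TE mulNr mulrC -exprMn inert_prod_ratios.
  by rewrite exprNn -signr_odd on; ring.
rewrite -TE -mulrA [_ ^+ n.+1 * _]mulrA -exprD.
(* The exponent (n + 1)^2 is a multiple of 2(n + 1) because n + 1 = 2m, so [y_norm] evaluates the
   power as (-1)^m. *)
have -> : (n.+1 + n * n.+1 = n.+1.*2 * m)%N by lia.
by rewrite exprM y_norm mulrA -exprMn mulrNN mulr1 expr1n mul1r.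
Qed.

Lemma form_prod_inert_even (m : nat) : n = m.*2 -> T = (- A ^+ 2 - 4) ^+ m.
Proof.
move=> nm; have [N cN] := form_prod_as_norm yP.
have h2 : h ^+ 2 = -1 by apply: sqr_prod_half_even; rewrite nm odd_double.
have D0 : A ^+ 2 + 4 != 0.
  (* Completing the square, f(A/2) = - (A^2 + 4)/4, so a zero discriminant would give a root. *)
  apply/eqP => D0; have /eqP := f_neq0 (A / 2); apply; rewrite /f.
  have two := half_two_neq0.
  have four : 4 != 0 :> F by rewrite (natrM _ 2 2) mulf_neq0.
  have -> : (A / 2) ^+ 2 - A * (A / 2) - 1 = - (A ^+ 2 + 4) / 4.
    by field; rewrite ?two ?four.
  by rewrite D0 oppr0 mul0r.
have d0 : d != 0.
  by have := D0; rewrite -(fmorph_eq0 phi) inert_disc expf_eq0.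
have y0 := root_neq0 yP.
have NE : N = n.-1.
  have := inert_card_ratios; have := half_card_gt0.
  by rewrite (ratio_partition_imag D0 addn _ h2) sum1_card cN /=; lia.
have := inert_prod_ratios; rewrite (ratio_partition_imag D0 *%R _ h2) /=.
rewrite rmorphN opprK.
have -> : (y - phi h) * (y + phi h) = y ^+ 2 - phi (h ^+ 2).
  by rewrite rmorphXn; ring.
rewrite h2 rmorphN rmorph1 opprK -inert_sqr_add1.
set W := \prod_(r | P' r) (y - phi r) => WE.
have {WE} WE : y ^+ 2 * W = -1.
  by apply: (mulIf d0); rewrite mulN1r -WE; ring.
rewrite (imag_lines nm D0) NE => TE.
apply: (fmorph_inj phi).
have oddE : (-1) ^+ n.-1 = -1 :> E.
  rewrite -signr_odd; have := half_card_gt0; rewrite nm.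
  by case: (m) => //= k _; rewrite odd_double.
(* A further factor y^(2n) turns W^n into (y^2 W)^n = 1. *)
have {}TE : y ^+ (n * n.+1) * phi T = phi ((A ^+ 2 + 4) ^+ m).
  have -> : (n * n.+1 = 2 * n + n * n.-1)%N by have := half_card_gt0; nia.
  rewrite exprD exprM -mulrA TE oddE rmorphN mulN1r mulrNN mulrA -exprMn WE.
  by rewrite -signr_odd nm odd_double mul1r.
have yE : y ^+ (n * n.+1) = (-1) ^+ m.
  by rewrite -y_norm -exprM; congr (_ ^+ _); lia.
apply: (mulfI (expf_neq0 (n * n.+1) y0)); rewrite TE yE.
rewrite -opprD [(- (A ^+ 2 + 4)) ^+ m]exprNn rmorphM.
rewrite [phi ((-1) ^+ m)]rmorphXn rmorphN rmorph1 mulrA.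
by rewrite -exprMn mulrNN mulr1 expr1n mul1r.
Qed.

End InertCase.

(** Double root: f(r) = (r - y)^2, so of the fixed ratios [y] and [- y] only [- y] contributes, and
    Z = h (-4y)^m. The powers of [y] and of the product over pairs cancel, leaving T = - Z, where
    4^m = 2^n = y^n = (-1)^m. *)
Lemma form_prod_double_root (y : F) (m : nat) :
  y ^+ 2 = -1 -> A = 2 * y -> n = m.*2 -> T = - (h * y ^+ m).
Proof.
move=> y2 Ay nm; have y0 := sqrN1_neq0 y2; have two := half_two_neq0.
have yP : y ^+ 2 = idfun A * y + 1 by rewrite /= Ay -mulrA -expr2 y2; ring.
have [N cN TE] := form_prod_as_norm yP.
have fE r : f r = (r - y) ^+ 2.
  have -> : (r - y) ^+ 2 = r ^+ 2 - 2 * y * r + y ^+ 2 by ring.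
  by rewrite /f Ay y2.
have imE r : (r != 0) && (f r != 0) && (r ^+ 2 == -1) = (r == - y).
  rewrite -y2 eqf_sqr fE expf_eq0 subr_eq0 /=.
  have [->|_] /= := eqVneq r y; last first.
    by have [->|_] := eqVneq r (- y); rewrite ?andbF // oppr_eq0 y0.
  by rewrite andbF eq_sym (negbTE (half_oppr_neq y0)).
have split3 (R : Type) (idx : R) (op : Monoid.com_law idx) (G : F -> R) :
    \big[op/idx]_r G r =
    op (G 0) (op (G y) (op (\big[op/idx]_(r | P' r) G r) (G (- y)))).
  rewrite (bigD1 0) // (bigD1 y) //=; do 2![congr (op _ _)].
  transitivity (\big[op/idx]_(r | (r != 0) && (f r != 0)) G r).
    by apply: eq_bigl => r; rewrite fE expf_eq0 subr_eq0.
  by rewrite ratio_partition (big_pred1 _ imE).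
have ZE : Z = h * (- 4 * y) ^+ m.
  have Ny2 : (- y) ^+ 2 = -1 by rewrite sqrrN.
  by rewrite /Z (big_pred1 _ imE) (line_imag Ny2 nm) Ay; congr (_ * _ ^+ _); ring.
have NE : N = n.-1.
  have := card_half; rewrite -sum1_card (split3 _ _ addn) sum1_card cN /=; lia.
have WE : 2 * \prod_(r | P' r) (y - r) = 1.
  have := prod_subr_punctured y; rewrite (split3 _ _ *%R) /= eqxx.
  rewrite eq_sym (negbTE y0) (negbTE (half_oppr_neq y0)) subr0 opprK mul1r.
  have -> : \prod_(r | P' r) (if r == y then 1 else y - r) = \prod_(r | P' r) (y - r).
    apply: eq_bigr => r /and3P[_]; rewrite fE expf_eq0 subr_eq0 /=.
    by move=> /negbTE->.
  set W := \prod_(r | P' r) _ => WE.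
  have -> : 2 * W = - (y ^+ 2 * 2 * W) by rewrite y2; ring.
  by rewrite -[RHS]opprK -WE; congr (- _); ring.
have yn : y ^+ n = (-1) ^+ m by rewrite nm -mul2n exprM y2.
have ynn : y ^+ n * y ^+ n = 1 by rewrite -exprD addnn expf_half.
(* The quadratic character of 2, from 2y = (1 + y)^2 when y^2 = -1. *)
have two_n : 2 ^+ n = y ^+ n.
  have y10 : 1 + y != 0.
    apply/eqP => e; move/eqP: (mulf_neq0 two y0); apply.
    have -> : 2 * y = (1 + y) ^+ 2 - (1 + y ^+ 2) by ring.
    by rewrite e y2 expr0n subrr subr0.
  have e : 2 * y = (1 + y) ^+ 2.
    have -> : (1 + y) ^+ 2 = 2 * y + (1 + y ^+ 2) by ring.
    by rewrite y2 subrr addr0.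
  apply: (mulIf (expf_neq0 n y0)).
  by rewrite -exprMn e -exprM mul2n expf_half.
have {WE} WE : (\prod_(r | P' r) (y - r)) ^+ n = y ^+ n.
  apply: (mulfI (expf_neq0 n two)).
  by rewrite -exprMn WE expr1n two_n ynn.
have oddE : (-1) ^+ N = -1 :> F.
  rewrite NE -signr_odd; have := half_card_gt0; rewrite nm.
  by case: (m) => //= k _; rewrite odd_double.
have yN : y ^+ (n * N) = y ^+ n.
  apply: (mulIf (expf_neq0 n y0)); rewrite ynn -exprD.
  have -> : (n * N + n = n.*2 * m)%N by have := half_card_gt0; rewrite NE nm; nia.
  by rewrite exprM expf_half // expr1n.
apply: (mulfI (expf_neq0 n y0)).
move: TE; rewrite yN oddE /= WE ZE => ->; rewrite mulN1r mulNr mulrN.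
have -> : -4 * y = 2 ^+ 2 * (-1 * y) :> F by ring.
rewrite exprMn [(-1 * y) ^+ m]exprMn -exprM mul2n -nm two_n yn.
by rewrite [(-1) ^+ m * (_ * y ^+ m)]mulrA -exprMn mulrNN mulr1 expr1n mul1r.
Qed.

End HalfSystem.

(** Binet's formula, multiplied out so that [y - z] needs no inverse. *)
Lemma lucas_u_binet (E : comPzRingType) (A : int) (y z : E) (k : nat) :
  y + z = A%:~R -> y * z = -1 ->
  (lucas_u A k)%:~R * (y - z) = y ^+ k - z ^+ k.
Proof.
move=> yz1 yz2; elim/ltn_ind: k => [[|[|k]]] IH; first by rewrite mul0r subrr.
  by rewrite mul1r.
rewrite -[lucas_u _ _]/(A * lucas_u A k.+1 + lucas_u A k) intrD intrM.
rewrite mulrDl -mulrA !IH // -yz1 !exprSr.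
have -> : y ^+ k * y * y - z ^+ k * z * z =
  (y + z) * (y ^+ k * y - z ^+ k * z) - (y * z) * (y ^+ k - z ^+ k) by ring.
by rewrite yz2 mulN1r opprK.
Qed.

(** * The prime field, with half-system 1, ..., (p - 1)/2 *)

Section PrimeField.

Variable p : nat.
Hypotheses (p_pr : prime p) (p_odd : odd p).

Let n := p.-1./2.
Let H (x : 'F_p) := (0 < x <= n)%N.

Lemma p_half : p = n.*2.+1.
Proof. by rewrite /n; have := prime_gt1 p_pr; lia. Qed.

Lemma eqz_mod_Fp (a b : int) : (a == b %[mod p%:Z])%Z = (a%:~R == b%:~R :> 'F_p).
Proof. by rewrite eqz_mod_dvd (dvdz_pcharf (pchar_Fp p_pr)) rmorphB subr_eq0. Qed.

Lemma Fp_half0 : ~~ H 0.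
Proof. by []. Qed.

Lemma Fp_halfN (x : 'F_p) : x != 0 -> H (- x) = ~~ H x.
Proof.
move=> x0; have x0' : (0 < x)%N by rewrite lt0n.
have := ltn_ord x; rewrite /H /=; move: (nat_of_ord x) x0' => k k0.
rewrite Fp_cast // => kp.
rewrite modn_small; last by rewrite ltn_subrL k0 prime_gt0.
by move: p_half; lia.
Qed.

Lemma big_Fp_half (R : Type) (idx : R) (op : Monoid.com_law idx) (G : 'F_p -> R) :
  \big[op/idx]_(1 <= i < n.+1) G i%:R = \big[op/idx]_(x | H x) G x.
Proof.
have nN : (n.+1 <= (Zp_trunc (pdiv p)).+2)%N.
  by rewrite Fp_cast //; have := p_half; have := prime_gt1 p_pr; lia.
rewrite (big_nat_widen _ _ _ _ _ nN) (big_nat_widenl _ 0) // big_mkord.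
by apply: eq_big => [x|x _]; rewrite ?natr_Zp //= ltnS andbC.
Qed.

Lemma card_Fp_half : #|H| = n.
Proof.
by rewrite -sum1_card -(big_Fp_half addn) /= sum_nat_const_nat subSS subn0 muln1.
Qed.

Lemma prod_Fp_half : \prod_(x | H x) x = n`!%:R.
Proof.
rewrite -(big_Fp_half *%R id) fact_prod (big_morph _ (natrM _) (erefl 1%:R)).
by [].
Qed.

Lemma Tp_Fp (A : int) :
  (Tp p 1 (- A) (-1))%:~R =
  \prod_(i | H i) \prod_(j | H j && (i ^+ 2 - A%:~R * i * j - j ^+ 2 != 0))
    (i ^+ 2 - A%:~R * i * j - j ^+ 2) :> 'F_p.
Proof.
rewrite /Tp -/n (big_morph _ (intrM _) (erefl 1%:~R)).
under [RHS]eq_bigr => i _ do rewrite big_mkcondr.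
rewrite -(big_Fp_half *%R) /=; apply: eq_bigr => i _.
rewrite -(big_Fp_half *%R) /= (big_morph _ (intrM _) (erefl 1%:~R)).
rewrite big_mkcond; apply: eq_bigr => j _.
rewrite (dvdz_pcharf (pchar_Fp p_pr)).
have -> : (1 * i%:Z ^+ 2 + - A * i%:Z * j%:Z + -1 * j%:Z ^+ 2)%:~R =
   i%:R ^+ 2 - A%:~R * i%:R * j%:R - j%:R ^+ 2 :> 'F_p.
  rewrite !(rmorphD, rmorphM, rmorphN, rmorphXn, rmorph1) /= -!pmulrn.
  by ring.
by [].
Qed.

(* Frobenius exchanges the two roots, whose product is [-1]. *)
Lemma inert_root_norm (A : 'F_p) (E : fieldType) (phi : {rmorphism 'F_p -> E}) (y : E) :
    (forall r, r ^+ 2 - A * r - 1 != 0) -> y ^+ 2 = phi A * y + 1 ->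
  y ^+ n.+1.*2 = -1.
Proof.
move=> f0 yP.
have charE : p \in [pchar E] by rewrite (fmorph_pchar phi) pchar_Fp.
have ypP : (y ^+ p) ^+ 2 = phi A * y ^+ p + 1.
  rewrite -exprM mulnC exprM yP -!(pFrobenius_autE charE) rmorphD rmorph1 rmorphM /=.
  congr (_ * _ + _); rewrite pFrobenius_autE -rmorphXn.
  by congr (phi _); rewrite -[RHS]expf_card card_Fp.
have : (y ^+ p - y) * (y ^+ p - (phi A - y)) = 0.
  have -> : (y ^+ p - y) * (y ^+ p - (phi A - y)) =
    (y ^+ p) ^+ 2 - phi A * y ^+ p + phi A * y - y ^+ 2 by ring.
  by rewrite ypP yP; ring.
move/eqP; rewrite mulf_eq0 => /orP[|/eqP/subr0_eq yp]; last first.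
  by rewrite doubleS -p_half exprSr yp mulrBl -expr2 yP; ring.
(* If y^p = y, a factor of prod_r (y - r) vanishes, so [y] comes from the prime field and is a root
   of [f] there, which is excluded. *)
have := prod_subr_all Fp_half0 Fp_halfN phi y.
rewrite card_Fp_half -p_half => <- /prodf_eq0[r _]; rewrite subr_eq0 => /eqP yr.
have /eqP := f0 r; case; apply: (fmorph_inj phi).
by rewrite !(rmorphB, rmorphXn, rmorphM, rmorph1, rmorph0) /= -yr yP; ring.
Qed.

Lemma quadratic_root_ext (A : 'F_p) :
  exists (E : fieldType) (phi : {rmorphism 'F_p -> E}) (y : E),
    y ^+ 2 = phi A * y + 1.
Proof.
pose q : {poly 'F_p} := 'X^2 - A *: 'X - 1.
have q2 : q`_2 = 1.
  by rewrite /q !coefB coefXn coefZ coefX coef1 /= mulr0 !subr0.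
have q0 : q != 0.
  by apply/eqP => e; move/eqP: q2; rewrite e coef0 eq_sym oner_eq0.
have [L [s qs _]] := FinSplittingFieldFor q0.
pose phi : {rmorphism 'F_p -> L} := GRing.in_alg L.
(* With an empty list of roots [q] would be associated to 1, but its coefficient of degree 2 is
   nonzero. *)
have [y ys] : exists y, y \in s.
  case: s qs => [|y s _]; last by exists y; rewrite mem_head.
  rewrite big_nil => /eqp_size; rewrite size_map_poly size_poly1 => sq.
  by move/eqP: q2; rewrite nth_default ?sq // eq_sym oner_eq0.
exists L, phi, y.
have : root (map_poly phi q) y by rewrite (eqp_root qs) root_prod_XsubC.
rewrite /q !(rmorphB, linearZ, rmorph1) /= map_polyZ map_polyXn map_polyX /root.
rewrite !hornerE.
by rewrite subr_eq0 subr_eq addrC => /eqP.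
Qed.

End PrimeField.

(* "x/2 == y (mod p)" is rendered as "x == 2*y (mod p)" (2 is invertible mod p). *)
Theorem theorem1p4 (p : nat) (A : int) :
  prime p -> odd p ->
  let h := ((p.-1)./2)`!%:Z in
  let T := Tp p 1 (- A) (-1) in
  (* (i) *)
  ((p%:Z %| A ^+ 2 + 4)%Z ->
     (p %% 4 = 1)%N /\
     exists k : nat, (k < 2)%N /\
       (A == 2 * ((-1) ^+ k * h) %[mod p%:Z])%Z /\
       ((p %% 8 = 1)%N -> (T == (-1) ^+ ((p + 7) %/ 8) * h %[mod p%:Z])%Z) /\
       ((p %% 8 = 5)%N -> (T == (-1) ^+ (k + (p - 5) %/ 8) %[mod p%:Z])%Z)) /\
  (* (ii) *)
  (legendre (A ^+ 2 + 4) p = 1 ->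
     ((p %% 4 = 1)%N -> (T == - (A ^+ 2 + 4) ^+ ((p - 1) %/ 4) %[mod p%:Z])%Z) /\
     ((p %% 4 = 3)%N ->
        (2 * T == - (A ^+ 2 + 4) ^+ ((p + 1) %/ 4) * lucas_u A ((p - 1) %/ 2)
           %[mod p%:Z])%Z)) /\
  (* (iii) *)
  (legendre (A ^+ 2 + 4) p = -1 ->
     ((p %% 4 = 1)%N -> (T == (- A ^+ 2 - 4) ^+ ((p - 1) %/ 4) %[mod p%:Z])%Z) /\
     ((p %% 4 = 3)%N ->
        (2 * T == (- A ^+ 2 - 4) ^+ ((p + 1) %/ 4) * lucas_u A ((p + 1) %/ 2)
           %[mod p%:Z])%Z)).
Proof.
move=> p_pr p_odd h T; set n := p.-1./2 in h *.
have pE : p = n.*2.+1 := p_half p_pr p_odd.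
pose a : 'F_p := A%:~R.
have H0 := Fp_half0 p; have HN := Fp_halfN p_pr p_odd.
have cH := card_Fp_half p_pr p_odd; have hE := prod_Fp_half p_pr p_odd.
have TE := Tp_Fp p_pr p_odd A; rewrite -/T -/a in TE.
have two : 2 != 0 :> 'F_p := half_two_neq0 HN.
have four : 4 != 0 :> 'F_p by rewrite (natrM _ 2 2) mulf_neq0.
have discE : (A ^+ 2 + 4)%:~R = a ^+ 2 + 4 :> 'F_p by rewrite rmorphD rmorphXn.
have NdiscE : (- A ^+ 2 - 4)%:~R = - a ^+ 2 - 4 :> 'F_p.
  by rewrite rmorphB rmorphN rmorphXn.
have hFE : h%:~R = n`!%:R :> 'F_p by [].
have dvdE : (p%:Z %| A ^+ 2 + 4)%Z = (a ^+ 2 + 4 == 0).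
  by rewrite (dvdz_pcharf (pchar_Fp p_pr)) discE.
have sqr_int (x : 'F_p) : ((x : nat)%:Z ^+ 2 == A ^+ 2 + 4 %[mod p%:Z])%Z =
    (x ^+ 2 == a ^+ 2 + 4).
  by rewrite eqz_mod_Fp // discE rmorphXn /= -pmulrn natr_Zp.
split; [|split].
- rewrite dvdE => /eqP D0; pose y := a / 2.
  have aE : a = 2 * y by rewrite /y mulrC divfK.
  have y2 : y ^+ 2 = -1.
    apply: (mulfI four); have -> : 4 * y ^+ 2 = (2 * y) ^+ 2 by ring.
    by rewrite -aE mulrN1; apply/eqP; rewrite -subr_eq0 opprK D0.
  have en : ~~ odd n.
    by apply/negP => on; have := sqr_neqN1 H0 HN y; rewrite cH y2 eqxx => /(_ on).
  have nm : n = n./2.*2 by rewrite -[LHS]odd_double_half (negbTE en).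
  have h2 : (n`!%:R : 'F_p) ^+ 2 = -1.
    by rewrite -hE; apply: sqr_prod_half_even => //; rewrite cH.
  have TF : T%:~R = - (n`!%:R * y ^+ n./2) :> 'F_p.
    by rewrite TE -hE; apply: form_prod_double_root; rewrite ?cH.
  split; first lia.
  (* Both [y] and n! are square roots of -1, so they agree up to sign. *)
  have [k k2 yk] : exists2 k, (k < 2)%N & y = (-1) ^+ k * n`!%:R.
    have /eqP : y ^+ 2 = n`!%:R ^+ 2 by rewrite y2 h2.
    rewrite eqf_sqr => /orP[]/eqP->; [exists 0%N|exists 1%N] => //.
      by rewrite mul1r.
    by rewrite mulN1r.
  exists k; split=> //; split; [|split].
  + by rewrite eqz_mod_Fp // !rmorphM rmorphXn rmorphN rmorph1 -/a aE yk.
  (* Here n/2 is even, so y^(n/2) = (-1)^(n/4); the leading minus sign accounts for the 1 in (p +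
     7)/8 = n/4 + 1. *)
  + move=> p8; rewrite eqz_mod_Fp // TF rmorphM rmorphXn rmorphN rmorph1 /= hFE.
    have -> : ((p + 7) %/ 8 = (n./2)./2.+1)%N by lia.
    have -> : (n./2 = 2 * (n./2)./2)%N by lia.
    rewrite exprM y2; apply/eqP.
    have -> : ((2 * n./2./2)./2 = n./2./2)%N by lia.
    by rewrite exprS; ring.
  (* Now n/2 is odd; the extra factor y = (-1)^k n! meets n!, and n!^2 = -1 cancels the minus
     sign. *)
  + move=> p8; rewrite eqz_mod_Fp // TF rmorphXn rmorphN rmorph1 /=.
    have -> : ((p - 5) %/ 8 = (n./2)./2)%N by lia.
    have -> : (n./2 = 2 * (n./2)./2 + 1)%N by lia.
    have -> : ((2 * n./2./2 + 1)./2 = n./2./2)%N by lia.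
    rewrite exprD exprM y2 expr1 yk exprD.
    set u := (-1) ^+ n./2./2; set v := (-1) ^+ k; apply/eqP.
    have -> : - (n`!%:R * (u * (v * n`!%:R))) = - (n`!%:R ^+ 2 * (v * u)) by ring.
    by rewrite h2 mulN1r opprK.
- rewrite /legendre dvdE; case: ifP => // /negbT D0; case: ifP => // /existsP[x0].
  have [x ->] : exists x : 'F_p, (x0 : nat) = x.
    have lt : (x0 < (Zp_trunc (pdiv p)).+2)%N by rewrite Fp_cast.
    by exists (Ordinal lt).
  rewrite sqr_int => /eqP x2 _.
  (* The quadratic formula, [x] being a square root of the discriminant. *)
  pose y := (a + x) / 2.
  have yP : y ^+ 2 = a * y + 1.
    apply: (mulfI four).
    have -> : 4 * y ^+ 2 = a ^+ 2 + 2 * a * x + x ^+ 2 by rewrite /y; field.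
    by rewrite x2 /y; field.
  split=> p4; rewrite eqz_mod_Fp //.
  + rewrite rmorphN rmorphXn /= discE TE; apply/eqP.
    apply: (form_prod_split_even H0 HN yP D0); rewrite cH; lia.
  + have on : odd n by lia.
    have dE := split_disc yP; have d0 := split_diff_neq0 yP D0.
    have y0 := split_neq0 yP; set d := y - (a - y) in dE d0.
    rewrite rmorphM /= TE (form_prod_split_odd H0 HN yP D0) ?cH //.
    rewrite -(split_sqr_add1 yP) -/d.
    rewrite rmorphM rmorphN rmorphXn /= discE dE -exprM.
    have -> : (2 * ((p + 1) %/ 4) = n.+1)%N by lia.
    have -> : ((p - 1) %/ 2 = n)%N by lia.
    have := lucas_u_binet n (subrKC y a) (split_mulr_conj yP); rewrite -/d => uE.
    (* The product of the roots is -1, [n] is odd and y^(2n) = 1. Binet's formula thus reads u_n d =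
       2 y^n, to be compared with T = - (y d)^n. *)
    have conjE : (a - y) ^+ n = - y ^+ n.
      apply: (mulfI (expf_neq0 n y0)); rewrite -exprMn (split_mulr_conj yP).
      have := expf_half H0 HN y0; rewrite cH mulrN -exprD addnn => ->.
      by rewrite -signr_odd on.
    rewrite exprSr mulNr -mulrA [d * _]mulrC uE conjE opprK exprMn.
    by apply/eqP; ring.
- rewrite /legendre dvdE; case: ifP => // /negbT D0; case: ifP => // /negbT nex _.
  (* A root [r] would make 2r - a a square root of the discriminant. *)
  have f0 r : r ^+ 2 - a * r - 1 != 0.
    apply: contra nex => /eqP fr; pose x := 2 * r - a.
    have lt : (x < p)%N by rewrite -[ltnRHS](Fp_cast p_pr).
    apply/existsP; exists (Ordinal lt); rewrite sqr_int.
    apply/eqP; apply: subr0_eq; rewrite -[RHS](mulr0 4) -fr /x; ring.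
  have [E [phi [y yP]]] := quadratic_root_ext a.
  have yNn : y ^+ n.+1.*2 = -1 := inert_root_norm p_pr p_odd f0 yP.
  have yN := yNn; rewrite -[n]cH in yN.
  split=> p4; rewrite eqz_mod_Fp //.
  + rewrite rmorphXn /= NdiscE TE; apply/eqP.
    apply: (form_prod_inert_even H0 HN yP f0 yN); rewrite cH; lia.
  + have nm : #|[pred x : 'F_p | 0 < x <= p.-1./2]%N|.+1 = (n.+1)./2.*2.
      by rewrite cH; lia.
    apply/eqP; apply: (fmorph_inj phi).
    have := form_prod_inert_odd H0 HN yP f0 yN nm; rewrite -TE => TE'.
    have dE := inert_disc yP; set d := y - (phi a - y) in TE' dE.
    have phia : y + (phi a - y) = A%:~R by rewrite subrKC /a rmorph_int.
    have := lucas_u_binet n.+1 phia (inert_mulr_conj yP); rewrite -/d => uE.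
    (* The minus sign now comes from y^(2(n+1)) = -1, as n + 1 is even; Binet's formula gives
       u_(n+1) d = 2 y^(n+1). *)
    have conjE : (phi a - y) ^+ n.+1 = - y ^+ n.+1.
      apply: (mulfI (expf_neq0 n.+1 (root_neq0 yP))); rewrite -exprMn.
      rewrite (inert_mulr_conj yP) mulrN -exprD addnn yNn opprK.
      by rewrite -signr_odd (_ : odd n.+1 = false) //; lia.
    rewrite conjE opprK in uE.
    rewrite !rmorphM /= TE' rmorphXn /= NdiscE -opprD rmorphXn rmorphN dE.
    rewrite !rmorph_int -[2%:~R]/(2 : E) cH.
    have -> : ((p + 1) %/ 4 = n.+1./2)%N by lia.
    have -> : ((p + 1) %/ 2 = n.+1)%N by lia.
    rewrite [(- d ^+ 2) ^+ _]exprNn -exprM mul2n -nm cH [d ^+ _.+1]exprSr.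
    rewrite -!mulrA [d * _]mulrC uE.
    ring.
Qed.
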